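(* Let $\lambda>-1$, $t\in\mathbb{R}$ and let $m\ge 2$ be an integer. Then the first moment $\mu_0(t;\lambda,m)=\int_{-\infty}^{\infty}|x|^{2\lambda+1}\exp(tx^2-x^{2m})\,dx$ of the generalised higher order Freud weight satisfies $$\mu_0(t;\lambda,m)=\int_0^\infty s^{\lambda}\exp(ts-s^m)\,ds=\frac1m\sum_{k=1}^m\frac{t^{k-1}}{(k-1)!}\,\Gamma\!\left(\frac{\lambda+k}{m}\right)\,{}_2F_m\!\left(\frac{\lambda+k}{m},1;\frac km,\frac{k+1}{m},\dots,\frac{m+k-1}{m};\left(\frac tm\right)^m\right),$$ and also $$\begin{aligned}\mu_0(t;\lambda,m)=&\ \frac1m\,\Gamma\!\left(\frac{\lambda+1}{m}\right)\,{}_1F_{m-1}\!\left(\frac{\lambda+1}{m};\frac1m,\dots,\frac{m-1}{m};\left(\frac tm\right)^m\right)\\ &+\frac1m\sum_{k=2}^{m-1}\frac{t^{k-1}}{(k-1)!}\,\Gamma\!\left(\frac{\lambda+k}{m}\right)\,{}_1F_{m-1}\!\left(\frac{\lambda+k}{m};\frac km,\frac{k+1}{m},\dots,\frac{m-1}{m},\frac{m+1}{m},\dots,\frac{m+k-1}{m};\left(\frac tm\right)^m\right)\\ &+\frac{t^{m-1}}{m!}\,\Gamma\!\left(\frac{\lambda}{m}+1\right)\,{}_1F_{m-1}\!\left(\frac{\lambda}{m}+1;\frac{m+1}{m},\frac{m+2}{m},\dots,\frac{2m-1}{m};\left(\frac tm\right)^m\right).\end{aligned}$$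
   Context: The generalised higher order Freud weight is $\omega(x;t,\lambda)=|x|^{2\lambda+1}\exp(tx^2-x^{2m})$ on $\mathbb{R}$. The generalised hypergeometric function is ${}_pF_q(a_1,\dots,a_p;b_1,\dots,b_q;z)=\sum_{j=0}^\infty \frac{(a_1)_j\cdots(a_p)_j}{(b_1)_j\cdots(b_q)_j}\frac{z^j}{j!}$, where $(a)_j=a(a+1)\cdots(a+j-1)$, $(a)_0=1$, is the Pochhammer symbol. Empty sums are zero. *)

(* Defs.v *)
From HB Require Import structures.
From mathcomp Require Import all_boot all_order all_algebra.
From mathcomp Require Import all_classical all_reals all_analysis.

Set Implicit Arguments.
Unset Strict Implicit.
Unset Printing Implicit Defensive.

Import Order.TTheory GRing.Theory Num.Theory.
Import numFieldNormedType.Exports.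

Local Open Scope classical_set_scope.
Local Open Scope ring_scope.

(* The value at x = 0 of a negative power is [0 `^ a = 0] in the library; this
   concerns a Lebesgue-null set only. *)
Definition freud_weight (R : realType) (m : nat) (t lambda x : R) : R :=
  `|x| `^ (2 * lambda + 1) * expR (t * x ^+ 2 - x ^+ (2 * m)).

(* Valued in the extended reals, so that equating it to a real number includes
   the convergence of the integral. *)
Definition freud_moment0 (R : realType) (m : nat) (t lambda : R) : \bar R :=
  (\int[@lebesgue_measure R]_x (freud_weight m t lambda x)%:E)%E.

(* Euler's integral: meaningful for [0 < a]. *)
Definition Gamma (R : realType) (a : R) : R :=
  \int[@lebesgue_measure R]_(x in `]0, +oo[) (x `^ (a - 1) * expR (- x)).

Definition pochhammer (R : realType) (a : R) (n : nat) : R :=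
  \prod_(i < n) (a + i%:R).

(* [hypergeometric [:: a_1; ...; a_p] [:: b_1; ...; b_q] z] is
   pFq(a_1, ..., a_p; b_1, ..., b_q; z). *)
Definition hypergeometric (R : realType) (A B : seq R) (z : R) : R :=
  limn (series (fun j : nat =>
    (\prod_(a <- A) pochhammer a j) / (\prod_(b <- B) pochhammer b j)
    * (z ^+ j / j`!%:R))).

(* Main.v *)
Require Import Defs.
From HB Require Import structures.
From mathcomp Require Import all_boot all_order all_algebra.
From mathcomp Require Import all_classical all_reals all_analysis.
From mathcomp Require Import measurable_realfun.
From mathcomp Require Import ring lra.

(** The weight is even, so the moment is twice an integral over the positive
    half-line, and the substitution [s = x ^ 2] turns it into
    [int_0^oo s^lambda exp(t s - s^m) ds]
    ([freud_moment0_half_line]).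

    Expanding [exp(t s)] and integrating term by term gives the power series
    [sum_i t^i/i! * 1/m * Gamma((lambda + 1 + i)/m)]: each term
    [int_0^oo s^(lambda + i) exp(-s^m) ds] is a Gamma value by the substitution
    [u = s ^ m] ([integral_powR_expRN_exprn]), and the interchange is dominated
    convergence with majorant [s^lambda exp(|t| s - s^m)], integrable because
    [s^m] with [m >= 2] beats every linear function
    ([cvg_series_moment_coef]). The same statement for [|t|] shows that the
    power series converges absolutely, so that it may be split according to the
    residue [p = k - 1] of [i] modulo [m] ([lim_series_residue_classes]).

    Within one class, [i = m j + p], the functional equation of Gamma gives
    [Gamma((lambda + k)/m + j) = Gamma((lambda + k)/m) ((lambda + k)/m)_j],
    and the multiplication formula
    [(m j + p)! = p! m^(m j) prod_(k <= i < m + k) (i/m)_j]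
    ([fact_pochhammer]) makes the class a hypergeometric series in [(t/m)^m];
    the upper parameter [1] compensates the [j!] that belongs to the definition
    of pFq ([moment_coef_residue_class]). This is the first expansion. The
    second follows by cancelling that [1] against the lower parameter [m/m],
    which occurs for every [k] between [1] and [m]
    ([hypergeometric_cancel_iota]).

    Since [lambda] may be negative, the integrands can be unbounded at [0]: all
    changes of variables and the integration by parts behind the functional
    equation are done on compact intervals of the open half-line, followed by a
    monotone limit ([cvg_integral_exhaustion]). *)

Set Implicit Arguments.
Unset Strict Implicit.
Unset Printing Implicit Defensive.

Import Order.TTheory GRing.Theory Num.Theory.
Import numFieldNormedType.Exports.

Local Open Scope classical_set_scope.
Local Open Scope ring_scope.

(** * Exhaustion of the half-line and changes of variables *)

(** Monotone convergence along compact intervals: this is how statements known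
    on segments are transferred to integrands that may blow up at [0]. *)
Lemma cvg_integral_exhaustion (R : realType) (f : R -> R) (a b : R^nat) :
  (forall x, 0 < x -> 0 <= f x) ->
  @measurable_fun _ _ R R `]0%R, +oo[ f ->
  (forall n, 0 < a n) ->
  {homo a : n p / (n <= p)%N >-> p <= n} ->
  {homo b : n p / (n <= p)%N >-> n <= p} ->
  (forall x, 0 < x -> exists n, a n <= x <= b n) ->
  (\int[@lebesgue_measure R]_(x in `[a n, b n]) (f x)%:E @[n --> \oo] -->
   \int[@lebesgue_measure R]_(x in `]0%R, +oo[) (f x)%:E)%E.
Proof.
move=> f0 mf a0 adecr bincr ab.
have sub0 n : `[a n, b n]%classic `<=` `]0, +oo[.
  by move=> x; rewrite /= !in_itv/= andbT => /andP[+ _]; exact: lt_le_trans.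
have -> : `]0, +oo[%classic = \bigcup_n `[a n, b n]%classic.
  apply/seteqP; split=> [x /=|x [n _]]; last exact: sub0.
  by rewrite in_itv/= andbT => /ab[n xn]; exists n.
apply: ge0_nondecreasing_set_cvg_integral => //.
- move=> n p np; rewrite subsetEset => x; rewrite /= !in_itv/=.
  move=> /andP[anx xbn]; rewrite (le_trans _ anx) ?adecr//=.
  by rewrite (le_trans xbn)// bincr.
- by move=> n; apply/measurable_EFinP; exact: measurable_funS mf.
- by move=> n x /sub0; rewrite /= in_itv/= andbT lee_fin; exact: f0.
Qed.

Lemma continuous_oy_measurable (R : realType) (f : R -> R) :
  {in `]0, +oo[, continuous f} -> @measurable_fun _ _ R R `]0%R, +oo[ f.
Proof.
move=> cf; apply: open_continuous_measurable_fun => // x.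
by rewrite inE; exact: cf.
Qed.

Lemma continuous_powR_gt0 (R : realType) (c x : R) :
  0 < x -> {for x, continuous (fun y : R => y `^ c)}.
Proof.
move=> x0; apply: differentiable_continuous; apply/derivable1_diffP.
by apply: derivable_powR; rewrite in_itv/= x0.
Qed.

Lemma pos_between_invS_S (R : realType) (x : R) : 0 < x ->
  exists n, n.+1%:R^-1 <= x <= n.+1%:R.
Proof.
move=> x0.
exists (maxn (Num.truncn x) (Num.truncn x^-1)).
apply/andP; split.
- rewrite -[leRHS]invrK lef_pV2 ?posrE ?invr_gt0//.
  rewrite (le_trans (ltW (truncnS_gt _)))// ler_nat ltnS.
  exact: leq_maxr.
- rewrite (le_trans (ltW (truncnS_gt _)))// ler_nat ltnS.
  exact: leq_maxl.
Qed.

Lemma invS_antitone (R : realType) :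
  {homo (fun n : nat => n.+1%:R^-1 : R) : n p / (n <= p)%N >-> p <= n}.
Proof. by move=> n p np; rewrite lef_pV2 ?posrE// ler_nat. Qed.

Lemma natS_monotone (R : realType) :
  {homo (fun n : nat => n.+1%:R : R) : n p / (n <= p)%N >-> n <= p}.
Proof. by move=> n p np; rewrite ler_nat. Qed.

Lemma cvg_integral_invS_S (R : realType) (f : R -> R) :
  (forall x, 0 < x -> 0 <= f x) -> {in `]0, +oo[, continuous f} ->
  (\int[@lebesgue_measure R]_(x in `[(n.+1%:R^-1)%R, n.+1%:R%R]) (f x)%:E @[n --> \oo]
   --> \int[@lebesgue_measure R]_(x in `]0%R, +oo[) (f x)%:E)%E.
Proof.
move=> f0 cf; apply: cvg_integral_exhaustion => //.
- exact: continuous_oy_measurable.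
- exact: invS_antitone.
- exact: natS_monotone.
- exact: pos_between_invS_S.
Qed.

(** The substitution [u = x ^ c] is performed on [[1/(n+1), n+1]], where
    [x ^ c] is continuously differentiable up to the end points; both sides
    then increase to the integrals over the half-line. *)
Lemma ge0_integration_by_substitution_powR (R : realType) (c : R) (G : R -> R) :
  0 < c -> {in `]0, +oo[, continuous G} -> (forall x, 0 < x -> 0 <= G x) ->
  (\int[@lebesgue_measure R]_(u in `]0%R, +oo[) (G u)%:E =
   \int[@lebesgue_measure R]_(x in `]0%R, +oo[)
     (G (x `^ c) * (c * x `^ (c - 1)))%:E)%E.
Proof.
move=> c0 cG G0.
pose F (x : R) := x `^ c.
pose a n : R := n.+1%:R^-1; pose b n : R := n.+1%:R.
have a0 n : 0 < a n by rewrite invr_gt0.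
have b0 n : 0 < b n by rewrite ltr0n.
have Fle x y : 0 < x -> 0 < y -> x <= y -> F x <= F y.
  by move=> x0 y0 xy; apply: ge0_ler_powR; rewrite ?nnegrE//; exact: ltW.
have cGF : {in `]0, +oo[, continuous (fun x => G (x `^ c) * (c * x `^ (c - 1)))}.
  move=> x; rewrite in_itv/= andbT => x0.
  apply: cvgM.
    apply: continuous_comp; first exact: continuous_powR_gt0.
    by apply: cG; rewrite in_itv/= powR_gt0.
  by apply: cvgM; [exact: cvg_cst|exact: continuous_powR_gt0].
have L : (\int[@lebesgue_measure R]_(x in `[F (a n), F (b n)]) (G x)%:E
    @[n --> \oo] --> \int[@lebesgue_measure R]_(x in `]0%R, +oo[) (G x)%:E)%E.
  apply: cvg_integral_exhaustion => //.
  - exact: continuous_oy_measurable.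
  - by move=> n; exact: powR_gt0.
  - by move=> n p np; apply: Fle => //; exact: invS_antitone.
  - by move=> n p np; apply: Fle => //; exact: natS_monotone.
  - move=> x x0; have [|n /andP[ax xb]] := @pos_between_invS_S R (x `^ c^-1).
      exact: powR_gt0.
    have xE : x = F (x `^ c^-1) by rewrite /F -powRrM mulVf ?gt_eqF// powRr1// ltW.
    exists n; rewrite xE; apply/andP; split; apply: Fle => //; exact: powR_gt0.
have L' : (\int[@lebesgue_measure R]_(x in `[a n, b n])
      (G (x `^ c) * (c * x `^ (c - 1)))%:E
    @[n --> \oo] --> \int[@lebesgue_measure R]_(x in `]0%R, +oo[)
      (G (x `^ c) * (c * x `^ (c - 1)))%:E)%E.
  apply: cvg_integral_invS_S => // x x0; rewrite mulr_ge0 ?G0 ?powR_gt0//.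
  by rewrite mulr_ge0 ?powR_ge0 ?ltW.
rewrite -(cvg_lim _ L)// -(cvg_lim _ L')//.
congr (limn _); apply/funext => n.
have cF' x : 0 < x -> {for x, continuous F^`()%classic}.
  move=> x0; rewrite /prop_for/continuous_at powR_derive1 ?in_itv/= ?x0//.
  have H : (fun y => c * y `^ (c - 1)) y @[y --> x] --> c * x `^ (c - 1).
    by apply: cvgM; [exact: cvg_cst|exact: continuous_powR_gt0].
  apply: cvg_trans H; apply: near_eq_cvg; near=> y.
  by rewrite powR_derive1// in_itv/= andbT; near: y; exact: lt_nbhsr.
have ab : a n <= b n.
  by rewrite (@le_trans _ _ 1)// ?invf_le1 ?ler1n.
have pos x : a n <= x -> 0 < x by exact: lt_le_trans.
rewrite (@integration_by_substitution_increasing _ F G (a n) (b n))//.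
- apply: eq_integral => x; rewrite inE/= in_itv/= => /andP[/pos x0 _].
  by rewrite !fctE /= /F powR_derive1 ?in_itv/= ?x0.
- move=> x y; rewrite !in_itv/= => /andP[/pos x0 _] /andP[/pos y0 _] xy.
  by apply: gt0_ltr_powR; rewrite ?nnegrE//; exact: ltW.
- by move=> x; rewrite in_itv/= => /andP[/ltW/pos x0 _]; exact: cF'.
- by apply/cvg_ex; eexists; apply: cvg_at_right_filter; apply: cF'.
- by apply/cvg_ex; eexists; apply: cvg_at_left_filter; apply: cF'.
- split.
  + move=> x; rewrite in_itv/= => /andP[/ltW/pos x0 _].
    by apply: derivable_powR; rewrite in_itv/= x0.
  + by apply: cvg_at_right_filter; exact: continuous_powR_gt0.
  + by apply: cvg_at_left_filter; exact: continuous_powR_gt0.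
- apply: continuous_in_subspaceT => x; rewrite inE/= in_itv/= => /andP[ax _].
  by apply: cG; rewrite in_itv/= andbT (lt_le_trans _ ax)// powR_gt0.
Unshelve. all: by end_near. Qed.

Lemma ge0_integral_oppr_oy (R : realType) (G : R -> R) :
  {in `]-oo, 0[, continuous G} -> (forall x, x < 0 -> 0 <= G x) ->
  (\int[@lebesgue_measure R]_(x in `]-oo, 0%R[) (G x)%:E =
   \int[@lebesgue_measure R]_(x in `]0%R, +oo[) (G (- x))%:E)%E.
Proof.
move=> cG G0.
pose a n : R := n.+1%:R^-1; pose b n : R := n.+1%:R.
have a0 n : 0 < a n by rewrite invr_gt0.
have cGN : {in `]0, +oo[, continuous (fun x => G (- x))}.
  move=> x; rewrite in_itv/= andbT => x0.
  apply: continuous_comp; first exact: opp_continuous.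
  by apply: cG; rewrite in_itv/= oppr_lt0.
have L : (\int[@lebesgue_measure R]_(x in `[a n, b n]) (G (- x))%:E @[n --> \oo]
    --> \int[@lebesgue_measure R]_(x in `]0%R, +oo[) (G (- x))%:E)%E.
  by apply: cvg_integral_invS_S => // x x0; rewrite G0// oppr_lt0.
have sub0 n : `[- b n, - a n]%classic `<=` `]-oo, 0[%classic.
  move=> x; rewrite /= !in_itv/= => /andP[_ xa].
  by rewrite (le_lt_trans xa)// oppr_lt0.
have L' : (\int[@lebesgue_measure R]_(x in `[(- b n)%R, (- a n)%R]) (G x)%:E
    @[n --> \oo] --> \int[@lebesgue_measure R]_(x in `]-oo, 0%R[) (G x)%:E)%E.
  have -> : `]-oo, 0%R[%classic = \bigcup_n `[- b n, - a n]%classic.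
    apply/seteqP; split=> [x /=|x [n _]]; last exact: sub0.
    rewrite in_itv/= -oppr_gt0 => /pos_between_invS_S[n /andP[anx xbn]].
    by exists n => //=; rewrite in_itv/= lerNl xbn lerNr.
  apply: ge0_nondecreasing_set_cvg_integral => //.
  - move=> n p np; rewrite subsetEset => x; rewrite /= !in_itv/=.
    move=> /andP[bx xa]; rewrite (le_trans _ bx) ?lerN2 ?natS_monotone//=.
    by rewrite (le_trans xa)// lerN2 invS_antitone.
  - move=> n; apply/measurable_EFinP; apply: (measurable_funS _ (@sub0 n)) => //.
    by apply: open_continuous_measurable_fun => // x; rewrite inE; exact: cG.
  - by move=> n x /sub0; rewrite /= in_itv/= lee_fin; exact: G0.
rewrite -(cvg_lim _ L)// -(cvg_lim _ L')//.
congr (limn _); apply/funext => n.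
rewrite integration_by_substitution_oppr//.
  by rewrite (@le_trans _ _ 1)// ?invf_le1 ?ler1n// ltr0n.
by apply: continuous_in_subspaceT => x; rewrite inE => /sub0; exact: cG.
Qed.

(** * The Gamma function *)

Lemma continuous_expRN (R : realType) : continuous (fun x : R => expR (- x)).
Proof.
by move=> x; apply: continuous_comp; [exact: opp_continuous|exact: continuous_expR].
Qed.

Lemma is_derive_NexpRN (R : realType) (x : R) :
  is_derive x 1 (fun y : R => - expR (- y)) (expR (- x)).
Proof. by apply: is_derive_eq; rewrite mulrN1 opprK. Qed.

Lemma integral_expRN_oy (R : realType) :
  (\int[@lebesgue_measure R]_(x in `]0%R, +oo[) (expR (- x))%:E = 1)%E.
Proof.
have dE := @is_derive_NexpRN R; have cE := @continuous_expRN R.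
rewrite integral_itv_obnd_cbnd; last first.
  by apply/measurable_EFinP; apply: measurable_funTS; exact: continuous_measurable_fun.
rewrite (@ge0_continuous_FTC2y R (fun x => expR (- x)) (fun x => - expR (- x)) 0 0).
- by rewrite oppr0 expR0 EFinN oppeK add0e.
- by move=> x _; exact: expR_ge0.
- exact: continuous_subspaceT.
- by rewrite -[X in _ --> X]oppr0; apply: cvgN; exact: cvgr_expR.
- by move=> x _; exact: ex_derive.
- by apply: cvg_at_right_filter; apply: cvgN; exact: cE.
- by move=> x _; rewrite derive1E derive_val.
Qed.

(** The extended-real integral of which [Gamma] is the finite part: the
    functional equation can be proved for it before finiteness is known. *)
Definition gamma_integral (R : realType) (a : R) : \bar R :=
  (\int[@lebesgue_measure R]_(x in `]0%R, +oo[) (x `^ (a - 1) * expR (- x))%:E)%E.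

Lemma continuous_gamma_integrand (R : realType) (a : R) :
  {in `]0, +oo[, continuous (fun x : R => x `^ a * expR (- x))}.
Proof.
move=> x; rewrite in_itv/= andbT => x0.
apply: cvgM; first exact: continuous_powR_gt0.
exact: continuous_expRN.
Qed.

(** For [a <= 1], [x^a <= 1 + x], so that the integrand is at most [e/a] times
    [exp(-x^a) a x^(a-1)], whose integral is that of [exp(-u)] by the
    substitution [u = x^a]. *)
Lemma gamma_integral_fin_num_le1 (R : realType) (a : R) :
  0 < a <= 1 -> gamma_integral a \is a fin_num.
Proof.
move=> /andP[a0 a1].
rewrite ge0_fin_numE; last first.
  by apply: integral_ge0 => x _; rewrite lee_fin mulr_ge0 ?powR_ge0 ?expR_ge0.
pose h (x : R) := expR (- (x `^ a)) * (a * x `^ (a - 1)).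
have hint : (\int[@lebesgue_measure R]_(x in `]0%R, +oo[) (h x)%:E = 1)%E.
  rewrite -(@ge0_integration_by_substitution_powR R a (fun u => expR (- u)))//.
  - exact: integral_expRN_oy.
  - by move=> x _; exact: continuous_expRN.
have ch : {in `]0, +oo[, continuous h}.
  move=> x; rewrite in_itv/= andbT => x0.
  apply: cvgM.
    apply: continuous_comp; last exact: continuous_expR.
    by apply: continuous_comp; [exact: continuous_powR_gt0|exact: opp_continuous].
  by apply: cvgM; [exact: cvg_cst|exact: continuous_powR_gt0].
have h0 (x : R) : 0 <= h x.
  by rewrite mulr_ge0 ?expR_ge0// mulr_ge0 ?powR_ge0// ltW.
rewrite /gamma_integral.
apply: (@le_lt_trans _ _
  (\int[@lebesgue_measure R]_(x in `]0%R, +oo[) ((expR 1 / a)%:E * (h x)%:E))%E).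
  apply: ge0_le_integral => //.
  - by move=> x _; rewrite lee_fin mulr_ge0 ?powR_ge0 ?expR_ge0.
  - apply/measurable_EFinP; apply: continuous_oy_measurable.
    exact: continuous_gamma_integrand.
  - apply/measurable_EFinP; apply: measurable_funM => //.
    exact: continuous_oy_measurable.
  - move=> x; rewrite /= in_itv/= andbT => x0; rewrite -EFinM lee_fin /h.
    have -> : expR 1 / a * (expR (- x `^ a) * (a * x `^ (a - 1))) =
        x `^ (a - 1) * (expR 1 * expR (- x `^ a)) by field; rewrite gt_eqF.
    rewrite ler_wpM2l ?powR_ge0// -expRD ler_expR.
    (* After taking logarithms, only the exponents have to be compared. *)
    suff : x `^ a <= 1 + x by lra.
    have [x1|/ltW x1] := leP 1 x.
      by rewrite (le_trans (ler1_powR x1 a1))// lerDr.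
    rewrite (@le_trans _ _ 1)// ?lerDl ?(ltW x0)//.
    by rewrite -[leRHS](powRr0 x) ger_powR ?x0//= ltW.
rewrite ge0_integralZl//.
- by rewrite hint mule1 ltry.
- by apply/measurable_EFinP; exact: continuous_oy_measurable.
- by move=> x _; rewrite lee_fin.
- by rewrite lee_fin divr_ge0 ?expR_ge0 ?ltW.
Qed.

(** The decay needed for the boundary term at infinity of the integration by
    parts: the exponential dominates one term of its series of degree larger
    than [a + 1]. *)
Lemma powR_mul_expRN_le (R : realType) (a : R) : 0 < a ->
  exists C : R, forall x, 1 <= x -> x `^ a * expR (- x) <= C * x^-1.
Proof.
move=> a0; pose k := Num.truncn (a + 1); exists (k.+1`!)%:R => x x1.
have x0 : 0 < x by rewrite (lt_le_trans _ x1).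
rewrite ler_pdivlMr// expRN mulrAC ler_pdivrMr ?expR_gt0//.
have -> : x `^ a * x = x `^ (a + 1).
  by rewrite powRD ?powRr1 ?(ltW x0)// (gt_eqF x0) implybT.
rewrite (@le_trans _ _ (x ^+ k.+1))//.
  rewrite -powR_mulrn ?(ltW x0)//.
  by rewrite ler_powR// ltW// truncnS_gt.
rewrite mulrC -ler_pdivrMr ?ltr0n ?fact_gt0//.
by rewrite (le_trans _ (expR_ge1Dxn k (ltW x0)))// lerDr.
Qed.

(** Integration by parts on [[1/(n+1), n+1]]; the boundary terms vanish in the
    limit, at [0] because [a > 0] and at infinity by exponential decay. Both
    sides may a priori be infinite, which makes this usable for proving
    finiteness. *)
Lemma gamma_integralD1 (R : realType) (a : R) : 0 < a ->
  (gamma_integral (a + 1) = a%:E * gamma_integral a)%E.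
Proof.
move=> a0.
pose l n : R := n.+1%:R^-1; pose b n : R := n.+1%:R.
have l0 n : 0 < l n by rewrite invr_gt0.
have L c : (\int[@lebesgue_measure R]_(x in `[l n, b n]) (x `^ c * expR (- x))%:E
    @[n --> \oo] -->
    \int[@lebesgue_measure R]_(x in `]0%R, +oo[) (x `^ c * expR (- x))%:E)%E.
  apply: cvg_integral_invS_S; last exact: continuous_gamma_integrand.
  by move=> x _; rewrite mulr_ge0 ?powR_ge0 ?expR_ge0.
(* The boundary terms of the integration by parts. *)
pose r n : R := l n `^ a * expR (- l n) - b n `^ a * expR (- b n).
have r0 : r n @[n --> \oo] --> 0.
  rewrite -[0](subrr 0); apply: cvgB.
    apply: (@squeeze_cvgr _ _ _ _ (cst 0) (fun n => l n `^ a)).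
    - apply: nearW => n; rewrite mulr_ge0 ?powR_ge0 ?expR_ge0//=.
      by rewrite ler_piMr ?powR_ge0// expR_le1 oppr_le0 ltW.
    - exact: cvg_cst.
    - have /cvg_at_rightP := @powR_cvg0 R a a0; apply; split=> //.
      exact: cvg_harmonic.
  have [C HC] := powR_mul_expRN_le a0.
  apply: (@squeeze_cvgr _ _ _ _ (cst 0) (fun n => C * harmonic n)).
  - apply: nearW => n; rewrite mulr_ge0 ?powR_ge0 ?expR_ge0//=.
    by apply: HC; rewrite ler1n.
  - exact: cvg_cst.
  - rewrite -[X in _ --> X](mulr0 C).
    by apply: cvgM; [exact: cvg_cst|exact: cvg_harmonic].
(* For [n = 0] the interval is the single point [1]. *)
have key n : (0 < n)%N ->
  (\int[@lebesgue_measure R]_(x in `[l n, b n]) (x `^ a * expR (- x))%:E =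
   (r n)%:E + a%:E *
    \int[@lebesgue_measure R]_(x in `[l n, b n]) (x `^ (a - 1) * expR (- x))%:E)%E.
  move=> n0.
  have sub : `[l n, b n]%classic `<=` `]0, +oo[%classic.
    by move=> x /=; rewrite !in_itv/= andbT => /andP[+ _]; exact: lt_le_trans.
  have subo x : x \in `]l n, b n[ -> 0 < x.
    by rewrite in_itv/= => /andP[+ _]; exact: lt_trans.
  have cw (f : R -> R) : {in `]0, +oo[, continuous f} ->
      {within `[l n, b n], continuous f}.
    by move=> cf; apply: continuous_in_subspaceT => x; rewrite inE => /sub; exact: cf.
  have mw (f : R -> R) : {in `]0, +oo[, continuous f} ->
      @measurable_fun _ _ R R `[l n, b n] f.
    by move=> cf; apply: (measurable_funS _ sub) => //; exact: continuous_oy_measurable.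
  have lb : l n < b n.
    by rewrite (@lt_trans _ _ 1)// ?invf_lt1// ?ltr1n ?ltr0n.
  have cP c : {in `]0, +oo[, continuous (fun x : R => x `^ c)}.
    by move=> x; rewrite in_itv/= andbT; exact: continuous_powR_gt0.
  rewrite (@integration_by_parts R (fun x => x `^ a) (fun x => - expR (- x))
    (fun x => a * x `^ (a - 1)) (fun x => expR (- x)))//.
  - have -> : b n `^ a * - expR (- b n) - l n `^ a * - expR (- l n) = r n.
      by rewrite /r; ring.
    congr (_ + _)%E.
    rewrite -ge0_integralZl//.
    + rewrite -[RHS]oppeK -integral_ge0N; last first.
        move=> x _; rewrite -EFinM lee_fin mulr_ge0 ?(ltW a0)//.
        by rewrite mulr_ge0 ?powR_ge0 ?expR_ge0.
      congr (- _)%E; apply: eq_integral => x _.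
      by rewrite -EFinM -EFinN; congr (_%:E); ring.
    + by apply/measurable_EFinP; apply: mw; exact: continuous_gamma_integrand.
    + by move=> x _; rewrite lee_fin mulr_ge0 ?powR_ge0 ?expR_ge0.
    + by rewrite lee_fin ltW.
  - by apply: cw => x x0; apply: cvgM; [exact: cvg_cst|exact: cP].
  - split.
    + by move=> x /subo x0; apply: derivable_powR; rewrite in_itv/= x0.
    + by apply: cvg_at_right_filter; exact: continuous_powR_gt0.
    + by apply: cvg_at_left_filter; exact: continuous_powR_gt0.
  - by move=> x /subo x0; rewrite powR_derive1// in_itv/= x0.
  - by apply: continuous_subspaceT; exact: continuous_expRN.
  - have dE := @is_derive_NexpRN R; split.
    + by move=> x _; exact: ex_derive.
    + by apply: cvg_at_right_filter; apply: cvgN; exact: continuous_expRN.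
    + by apply: cvg_at_left_filter; apply: cvgN; exact: continuous_expRN.
  - have dE := @is_derive_NexpRN R.
    by move=> x _; rewrite derive1E derive_val.
rewrite /gamma_integral addrK.
rewrite -(cvg_lim _ (L a))//; apply/cvg_lim => //.
have H : ((r n)%:E + a%:E *
    \int[@lebesgue_measure R]_(x in `[l n, b n]) (x `^ (a - 1) * expR (- x))%:E
  @[n --> \oo] --> 0%:E + a%:E *
  \int[@lebesgue_measure R]_(x in `]0%R, +oo[) (x `^ (a - 1) * expR (- x))%:E)%E.
  apply: cvgeD; first exact: fin_num_adde_defr.
    by apply/cvg_EFin; [exact: nearW|exact: r0].
  by apply: cvgeZl.
rewrite add0e in H; apply: cvg_trans H; apply: near_eq_cvg; near=> n.
by rewrite key//; near: n; exact: nbhs_infty_gt.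
Unshelve. all: by end_near. Qed.

(** Induction on the integer part of [a], descending to [a <= 1] with the
    functional equation. *)
Lemma gamma_integral_fin_num (R : realType) (a : R) :
  0 < a -> gamma_integral a \is a fin_num.
Proof.
move=> a0; have := truncnS_gt a; move: (Num.truncn a) => n.
elim: n a a0 => [|n ih] a a0 an.
  by apply: gamma_integral_fin_num_le1; rewrite a0 ltW.
have [a1|a1] := leP a 1; first by apply: gamma_integral_fin_num_le1; rewrite a0.
rewrite -(subrK 1 a) gamma_integralD1 ?subr_gt0// fin_numM// ih ?subr_gt0//.
by rewrite ltrBlDr natr1.
Qed.

Lemma GammaE (R : realType) (a : R) : Gamma a = fine (gamma_integral a).
Proof. by []. Qed.

Lemma GammaD1 (R : realType) (a : R) : 0 < a -> Gamma (a + 1) = a * Gamma a.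
Proof.
by move=> a0; rewrite !GammaE gamma_integralD1// fineM// gamma_integral_fin_num.
Qed.

Lemma pochhammerS (R : realType) (a : R) n :
  pochhammer a n.+1 = pochhammer a n * (a + n%:R).
Proof. by rewrite /pochhammer big_ord_recr. Qed.

Lemma GammaDn (R : realType) (a : R) n :
  0 < a -> Gamma (a + n%:R) = Gamma a * pochhammer a n.
Proof.
move=> a0; elim: n => [|n ih].
  by rewrite addr0 /pochhammer big_ord0 mulr1.
rewrite -natr1 addrA GammaD1; first by rewrite ih pochhammerS; ring.
by rewrite ltr_wpDr.
Qed.

Lemma Gamma_ge0 (R : realType) (a : R) : 0 <= Gamma a.
Proof.
rewrite GammaE; apply: fine_ge0; apply: integral_ge0 => x _.
by rewrite lee_fin mulr_ge0 ?powR_ge0 ?expR_ge0.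
Qed.

(** * Expansion of the half-line moment as a power series *)

Lemma continuous_gt0_powR_exp (R : realType) (mu t : R) (m : nat) :
  {in `]0, +oo[, continuous (fun s : R => s `^ mu * expR (t * s - s ^+ m))}.
Proof.
move=> s; rewrite in_itv/= andbT => s0.
apply: cvgM; first exact: continuous_powR_gt0.
apply: continuous_comp; last exact: continuous_expR.
apply: cvgB; last exact: exprn_continuous.
by apply: cvgM; [exact: cvg_cst|exact: cvg_id].
Qed.

(** Euler's integral at [(mu + 1)/m] after the substitution [u = s ^ m]. *)
Lemma integral_powR_expRN_exprn (R : realType) (mu : R) (m : nat) :
  -1 < mu -> (0 < m)%N ->
  (\int[@lebesgue_measure R]_(s in `]0%R, +oo[) (s `^ mu * expR (- s ^+ m))%:E =
   (m%:R^-1 * Gamma ((mu + 1) / m%:R))%:E)%E.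
Proof.
move=> mu1 m0; have m0R : 0 < m%:R :> R by rewrite ltr0n.
set a := (mu + 1) / m%:R.
have a0 : 0 < a by rewrite divr_gt0// -ltrBlDr sub0r.
have E : gamma_integral a = (m%:R%:E *
    \int[@lebesgue_measure R]_(s in `]0%R, +oo[) (s `^ mu * expR (- s ^+ m))%:E)%E.
  rewrite /gamma_integral (@ge0_integration_by_substitution_powR _ m%:R)//.
  - rewrite -ge0_integralZl//.
    + apply: eq_integral => s; rewrite inE/= in_itv/= andbT => s0.
      rewrite -EFinM; congr (_%:E).
      rewrite -(powR_mulrn m (ltW s0)) -powRrM.
      have -> : s `^ mu = s `^ (m%:R * (a - 1)) * s `^ (m%:R - 1).
        rewrite -powRD ?(gt_eqF s0) ?implybT//; congr (_ `^ _).
        by rewrite /a; field; rewrite gt_eqF.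
      by ring.
    + apply/measurable_EFinP; apply: continuous_oy_measurable => x x0.
      have := @continuous_gt0_powR_exp R mu 0 m x x0.
      by under eq_fun do rewrite mul0r add0r.
    + by move=> x _; rewrite lee_fin mulr_ge0 ?powR_ge0 ?expR_ge0.
  - exact: continuous_gamma_integrand.
  - by move=> x _; rewrite mulr_ge0 ?powR_ge0 ?expR_ge0.
rewrite EFinM GammaE fineK ?gamma_integral_fin_num// E muleA -EFinM mulVf ?gt_eqF//.
by rewrite mul1e.
Qed.

(** The super-linear growth of [s ^ m], and the place where [m >= 2] matters. *)
Lemma linear_sub_exprn_le (R : realType) (q s : R) (m : nat) :
  (2 <= m)%N -> 0 <= q -> 0 <= s -> q * s - s ^+ m <= q + q ^+ 2.
Proof.
move=> m2 q0 s0; have [s1|/ltW s1] := leP s 1.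
  have : q * s <= q by rewrite ler_piMr.
  by have : 0 <= s ^+ m := exprn_ge0 m s0; have := sqr_ge0 q; lra.
have : s ^+ 2 <= s ^+ m by rewrite ler_weXn2l.
by nra.
Qed.

(** By [linear_sub_exprn_le] with slope [|t| + 1], the integrand is at most a
    constant times [s^lambda exp(-s)], the integrand of
    [Gamma (lambda + 1)]. *)
Lemma integrable_powR_exp (R : realType) (lambda t : R) (m : nat) :
  -1 < lambda -> (2 <= m)%N ->
  (@lebesgue_measure R).-integrable `]0, +oo[
    (fun s => (s `^ lambda * expR (t * s - s ^+ m))%:E).
Proof.
move=> l1 m2.
have mf : @measurable_fun _ _ R (\bar R) `]0%R, +oo[
    (fun s : R => (s `^ lambda * expR (t * s - s ^+ m))%:E).
  apply/measurable_EFinP; apply: continuous_oy_measurable.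
  exact: continuous_gt0_powR_exp.
have mg : @measurable_fun _ _ R (\bar R) `]0%R, +oo[
    (fun s : R => (s `^ lambda * expR (- s))%:E).
  apply/measurable_EFinP; apply: continuous_oy_measurable.
  exact: continuous_gamma_integrand.
pose q := `|t| + 1; pose C := expR (q + q ^+ 2).
have q0 : 0 <= q by rewrite addr_ge0.
have ig : (@lebesgue_measure R).-integrable `]0, +oo[
    (fun s => (s `^ lambda * expR (- s))%:E).
  apply/integrableP; split => //.
  under eq_integral do rewrite gee0_abs ?lee_fin ?mulr_ge0 ?powR_ge0 ?expR_ge0//.
  have := @gamma_integral_fin_num R (lambda + 1).
  rewrite -ltrBlDr sub0r => /(_ l1); rewrite fin_numElt => /andP[_].
  by rewrite /gamma_integral addrK.
have iCg : (@lebesgue_measure R).-integrable `]0, +oo[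
    (fun s => C%:E * (s `^ lambda * expR (- s))%:E)%E by exact: integrableZl.
apply: (le_integrable _ _ _ iCg) => //.
- move=> s; rewrite /= in_itv/= andbT => /ltW s0.
  rewrite lee_fin !ger0_norm ?mulr_ge0 ?powR_ge0 ?expR_ge0//.
  rewrite mulrCA ler_wpM2l ?powR_ge0// -expRD ler_expR.
  (* The extra unit in [q] pays for the factor [exp(-s)] of the majorant. *)
  have := linear_sub_exprn_le m2 q0 s0; rewrite /q.
  have : t * s <= `|t| * s by rewrite ler_wpM2r// ler_norm.
  lra.
Qed.

(** The contribution of the term [(t s)^i / i!] of [exp(t s)] to the moment. *)
Definition moment_coef (R : realType) (m : nat) (t lambda : R) (i : nat) : R :=
  t ^+ i / i`!%:R * (m%:R^-1 * Gamma ((lambda + 1 + i%:R) / m%:R)).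

Lemma norm_series_exp_coeff_le (R : realType) (x : R) n :
  `|series (exp_coeff x) n| <= expR `|x|.
Proof.
apply: (@le_trans _ _ (series (exp_coeff `|x|) n)).
  rewrite -normed_series_exp_coeff; exact: ler_norm_sum.
apply: nondecreasing_cvgn_le; last exact: is_cvg_series_exp_coeff.
apply/nondecreasing_seqP => k; rewrite /series/= big_nat_recr//= lerDl.
exact: exp_coeff_ge0.
Qed.

(** Dominated convergence for the partial sums of [exp(t s)], which are bounded
    by [exp(|t| s)]. *)
Lemma cvg_series_moment_coef (R : realType) (lambda t : R) (m : nat) :
  -1 < lambda -> (2 <= m)%N ->
  ((series (moment_coef m t lambda) n)%:E @[n --> \oo] -->
  \int[@lebesgue_measure R]_(s in `]0%R, +oo[)
     (s `^ lambda * expR (t * s - s ^+ m))%:E)%E.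
Proof.
move=> l1 m2.
pose f_ n s := (s `^ lambda * expR (- s ^+ m) * series (exp_coeff (t * s)) n)%:E.
have li i : -1 < lambda + i%:R by rewrite (lt_le_trans l1)// lerDl.
have m0 : (0 < m)%N by exact: leq_trans m2.
(* The monomial moments are the case [t = 0] of [integrable_powR_exp], which
   explains the vanishing slope in the exponent. *)
have integ i : (@lebesgue_measure R).-integrable `]0, +oo[
    (fun s => (t ^+ i / i`!%:R)%:E *
       (s `^ (lambda + i%:R) * expR (0 * s - s ^+ m))%:E)%E.
  by apply: integrableZl => //; exact: integrable_powR_exp.
have f_E n s : 0 < s -> (f_ n s = \sum_(0 <= i < n) (t ^+ i / i`!%:R)%:E *
       (s `^ (lambda + i%:R) * expR (0 * s - s ^+ m))%:E)%E.
  move=> s0; under eq_bigr do rewrite -EFinM.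
  rewrite sumEFin /f_ /series/= mulr_sumr; congr (_%:E).
  apply: eq_bigr => i _; rewrite /exp_coeff/= mul0r sub0r exprMn.
  by rewrite powRD ?(gt_eqF s0) ?implybT// (powR_mulrn i (ltW s0)); ring.
have fint n : (\int[@lebesgue_measure R]_(s in `]0%R, +oo[) f_ n s =
    (series (moment_coef m t lambda) n)%:E)%E.
  transitivity (\int[@lebesgue_measure R]_(s in `]0%R, +oo[)
     \sum_(0 <= i < n) (t ^+ i / i`!%:R)%:E *
       (s `^ (lambda + i%:R) * expR (0 * s - s ^+ m))%:E)%E.
    apply: eq_integral => s; rewrite inE/= in_itv/= andbT; exact: f_E.
  rewrite integral_sum// -sumEFin; apply: eq_bigr => i _.
  rewrite integralZl//; last exact: integrable_powR_exp.
  under eq_integral do rewrite mul0r sub0r.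
  by rewrite integral_powR_expRN_exprn// -EFinM addrAC.
rewrite (_ : (fun n => _) =
   (fun n => \int[@lebesgue_measure R]_(s in `]0%R, +oo[) f_ n s)%E); last first.
  by apply/funext => n; rewrite fint.
apply: (@dominated_cvg _ _ R (@lebesgue_measure R) `]0%R, +oo[ _ f_
  (fun s => (s `^ lambda * expR (t * s - s ^+ m))%:E)
  (fun s => (s `^ lambda * expR (`|t| * s - s ^+ m))%:E)) => //.
- move=> n; apply: (@eq_measurable_fun _ _ _ _ _
     (fun s => (\sum_(0 <= i < n) (t ^+ i / i`!%:R)%:E *
       (s `^ (lambda + i%:R) * expR (0 * s - s ^+ m))%:E)%E)).
    by move=> s; rewrite inE/= in_itv/= andbT => /f_E ->.
  apply: emeasurable_sum => i; exact: measurable_int (integ i).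
- move=> s; rewrite /= in_itv/= andbT => s0; apply: cvg_EFin; first exact: nearW.
  rewrite expRD (mulrC (expR (t * s))) mulrA.
  apply: cvgM; first exact: cvg_cst.
  exact: is_cvg_series_exp_coeff.
- exact: integrable_powR_exp.
- move=> n s; rewrite /= in_itv/= andbT => s0.
  rewrite lee_fin normrM (ger0_norm (mulr_ge0 _ _)) ?powR_ge0 ?expR_ge0//.
  rewrite addrC expRD mulrA ler_wpM2l ?mulr_ge0 ?powR_ge0 ?expR_ge0//.
  rewrite -[X in `|t| * X](ger0_norm (ltW s0)) -normrM.
  exact: norm_series_exp_coeff_le.
Qed.

(** The absolute values of the coefficients at [t] are the coefficients at
    [|t|], and their sum is a finite integral. *)
Lemma cvg_normed_series_moment_coef (R : realType) (lambda t : R) (m : nat) :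
  -1 < lambda -> (2 <= m)%N -> cvgn [normed series (moment_coef m t lambda)].
Proof.
move=> l1 m2.
have -> : [normed series (moment_coef m t lambda)] =
    series (moment_coef m `|t| lambda).
  apply/funext => n; apply: eq_bigr => i _ /=.
  rewrite /moment_coef normrM; congr (_ * _).
    by rewrite normrM normrX normfV [X in _ / X]ger0_norm.
  by rewrite ger0_norm// mulr_ge0 ?Gamma_ge0.
have := @cvg_series_moment_coef R lambda `|t| m l1 m2.
rewrite -[X in _ --> X]fineK; last first.
  exact: integrable_fin_num (integrable_powR_exp `|t| l1 m2).
by move=> /fine_cvgP[_ cv]; apply/cvg_ex; eexists; exact: cv.
Qed.

(** * Pochhammer symbols and factorials *)

Lemma fact_addn (n m : nat) :
  ((n + m)`! = n`! * \prod_(0 <= i < m) (n + i.+1))%N.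
Proof.
elim: m => [|m ih]; first by rewrite addn0 big_geq// muln1.
by rewrite addnS factS ih big_nat_recr//= addnS mulnC mulnA.
Qed.

Lemma pochhammer_gt0 (R : realType) (a : R) n : 0 < a -> 0 < pochhammer a n.
Proof. by move=> a0; apply: prodr_gt0 => i _; rewrite ltr_wpDr. Qed.

Lemma pochhammer1 (R : realType) n : pochhammer 1 n = n`!%:R :> R.
Proof.
elim: n => [|n ih]; first by rewrite /pochhammer big_ord0.
by rewrite pochhammerS ih factS natrM nat1r mulrC.
Qed.

(** Gauss's multiplication formula for the factorial. Passing from [j] to
    [j + 1] multiplies the left-hand side by [m] consecutive integers
    [m j + i], [p < i <= m + p], and each of them is [m (i/m + j)]. *)
Lemma fact_pochhammer (R : realType) (m p j : nat) : (0 < m)%N ->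
  (m * j + p)`!%:R = p`!%:R * m%:R ^+ (m * j) *
    \prod_(p.+1 <= i < m + p.+1) pochhammer (i%:R / m%:R) j :> R.
Proof.
move=> m0; have m0R : m%:R != 0 :> R by rewrite pnatr_eq0 -lt0n.
elim: j => [|j ih].
  rewrite muln0 add0n expr0 mulr1 big1 ?mulr1// => i _.
  by rewrite /pochhammer big_ord0.
rewrite mulnS -addnA addnC fact_addn natrM ih.
under [in RHS]eq_bigr do rewrite pochhammerS.
rewrite big_split/= exprD.
set P := \prod_(_ <= _ < _) pochhammer _ _.
suff -> : (\prod_(0 <= i < m) (m * j + p + i.+1))%:R =
    m%:R ^+ m * \prod_(p.+1 <= i < m + p.+1) (i%:R / m%:R + j%:R) :> R.
  by ring.
rewrite natr_prod -{1}(add0n p.+1) big_addn addnK.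
rewrite -[in X in X * _](subn0 m) -prodr_const_nat -big_split/=.
apply: eq_bigr => i _; rewrite subn0 !(natrD, natrM) -!natr1; field.
exact: m0R.
Qed.

(** * Splitting an absolutely convergent series by residues *)

Lemma sum_residue_classes (R : nmodType) (u : nat -> R) (m n : nat) :
  \sum_(0 <= i < n * m) u i =
  \sum_(0 <= p < m) \sum_(0 <= j < n) u (m * j + p)%N.
Proof.
rewrite big_nat_mul exchange_big_nat//=; apply: eq_bigr => j _.
rewrite -{1}(add0n (j * m)%N) big_addn mulSn addnK.
by apply: eq_bigr => p _; rewrite addnC mulnC.
Qed.

(** The partial sums of the absolute values along one class are bounded by
    those of the whole series. *)
Lemma cvg_series_residue_class (R : realType) (u : R^nat) (m p : nat) :
  cvgn [normed series u] -> (p < m)%N ->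
  cvgn (series (fun j => u (m * j + p)%N)).
Proof.
move=> cu pm; apply: normed_cvg.
apply: nondecreasing_is_cvgn.
  apply/nondecreasing_seqP => n.
  by rewrite /= /series/= big_nat_recr//= lerDl.
exists (limn [normed series u]) => _ [n _ <-].
apply: (@le_trans _ _ ([normed series u] (n * m)%N)); last first.
  apply: nondecreasing_cvgn_le => //.
  apply/nondecreasing_seqP => k.
  by rewrite /= /series/= big_nat_recr//= lerDl.
rewrite /= /series/= sum_residue_classes [leRHS]big_mkord.
rewrite (bigD1 (Ordinal pm))//= lerDl sumr_ge0// => i _.
by rewrite sumr_ge0.
Qed.

Lemma cvg_sum_nat (R : realType) (m : nat) (f : nat -> R^nat) (l : nat -> R) :
  (forall i, (i < m)%N -> f i n @[n --> \oo] --> l i) ->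
  \sum_(0 <= i < m) f i n @[n --> \oo] --> \sum_(0 <= i < m) l i.
Proof.
elim: m => [_|m ih fl].
  by rewrite big_geq//; under eq_fun do rewrite big_geq//; exact: cvg_cst.
rewrite big_nat_recr//=; under eq_fun do rewrite big_nat_recr//=.
by apply: cvgD; [apply: ih => i im; apply: fl; exact: ltnW|exact: fl].
Qed.

(** Evaluating the partial sums at the multiples of [m], each class has the same
    number of terms, and the limit can be taken class by class. *)
Lemma lim_series_residue_classes (R : realType) (u : R^nat) (m : nat) :
  (0 < m)%N -> cvgn [normed series u] ->
  limn (series u) =
  \sum_(0 <= p < m) limn (series (fun j => u (m * j + p)%N)).
Proof.
move=> m0 cu; have cs : cvgn (series u) by exact: normed_cvg.
have L : series u (n * m)%N @[n --> \oo] --> limn (series u).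
  by apply: cvg_comp; [exact: cvg_mulnr|exact: cs].
rewrite -(cvg_lim _ L)//; apply: cvg_lim => //.
under eq_fun do rewrite /series/= sum_residue_classes.
by apply: cvg_sum_nat => p pm; exact: cvg_series_residue_class.
Qed.

(** Convergence is assumed of the scaled series only: for [K = 0] both sides
    vanish, and for [K != 0] the series of [h] converges too. This covers
    [t = 0], which makes the prefactor of a hypergeometric function vanish. *)
Lemma lim_seriesMl (R : realType) (K : R) (h : R^nat) :
  cvgn (series (fun j => K * h j)) ->
  limn (series (fun j => K * h j)) = K * limn (series h).
Proof.
have [-> _|K0 cKh] := eqVneq K 0.
  rewrite mul0r (_ : series _ = fun=> 0); first exact: lim_cst.
  by apply/funext => n; apply: big1 => j _; rewrite mul0r.
have hE : h = K^-1 *: (fun j => K * h j).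
  by apply/funext => j; rewrite -[LHS](mulKf K0).
by apply: (@lim_seriesZ _ h K); rewrite hE; exact: is_cvg_seriesZ.
Qed.

(** * The moment as a sum of hypergeometric functions *)

(** Half of the moment is the integral of the weight over the positive
    half-line, and [s = x ^ 2] contributes the Jacobian [2 x]. The point [0],
    where the weight can be discontinuous, has measure zero. *)
Lemma freud_moment0_half_line (R : realType) (lambda t : R) (m : nat) :
  freud_moment0 m t lambda =
  (\int[@lebesgue_measure R]_(s in `]0%R, +oo[)
     (s `^ lambda * expR (t * s - s ^+ m))%:E)%E.
Proof.
pose w := freud_weight m t lambda.
have w0 x : 0 <= w x by rewrite mulr_ge0 ?powR_ge0 ?expR_ge0.
have wN x : w (- x) = w x.
  by rewrite /w /freud_weight normrN sqrrN !exprM sqrrN.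
have cw : {in `]0, +oo[, continuous w}.
  move=> x; rewrite in_itv/= andbT => x0; apply: cvgM.
    apply: (@continuous_comp _ _ _ (fun x : R => `|x|) (fun y => y `^ _)).
      exact: norm_continuous.
    by apply: continuous_powR_gt0; rewrite normr_gt0 gt_eqF.
  apply: continuous_comp; last exact: continuous_expR.
  apply: cvgB; last exact: exprn_continuous.
  by apply: cvgM; [exact: cvg_cst|exact: exprn_continuous].
have cwN : {in `]-oo, 0[, continuous w}.
  move=> x; rewrite in_itv/= => x0.
  have -> : w = w \o -%R by apply/funext => y; rewrite /= wN.
  apply: continuous_comp; first exact: opp_continuous.
  by apply: cw; rewrite in_itv/= oppr_gt0 x0.
have mw : measurable_fun setT w.
  apply: measurable_funM.
    exact: (measurableT_comp (@measurable_powR R _) (@normr_measurable R setT)).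
  apply: measurableT_comp => //; apply: measurable_funB => //.
  exact: measurable_funM.
rewrite /freud_moment0 -/w.
have -> : (\int[@lebesgue_measure R]_x (w x)%:E =
   \int[@lebesgue_measure R]_(x in `]-oo, 0%R[) (w x)%:E +
   \int[@lebesgue_measure R]_(x in `]0%R, +oo[) (w x)%:E)%E.
  rewrite -(setUv `]-oo, 0%R]%classic) ge0_integral_setU//=.
  - rewrite setCitvl; congr (_ + _)%E.
    rewrite integral_itv_bndo_bndc//.
    by apply/measurable_EFinP; exact: measurable_funTS.
  - exact: measurableC.
  - by apply/measurable_EFinP; rewrite setUv.
  - by move=> x _; rewrite lee_fin.
  - by apply/disj_set2P; rewrite setICr.
rewrite ge0_integral_oppr_oy//.
under eq_integral do rewrite wN.
rewrite (@ge0_integration_by_substitution_powR R 2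
  (fun s => s `^ lambda * expR (t * s - s ^+ m)))//; last 2 first.
- exact: continuous_gt0_powR_exp.
- by move=> x _; rewrite mulr_ge0 ?powR_ge0 ?expR_ge0.
rewrite -[LHS]mule2n -mule_natl -ge0_integralZl//; first last.
- by move=> x _; rewrite lee_fin.
- by apply/measurable_EFinP; exact: continuous_oy_measurable.
apply: eq_integral => x; rewrite inE/= in_itv/= andbT => x0.
rewrite -EFinM; congr (_%:E).
rewrite /w /freud_weight gtr0_norm// -powRrM.
have -> : x `^ (2 * lambda + 1) = x `^ (2 * lambda) * x `^ (2 - 1).
  by rewrite -powRD ?(gt_eqF x0) ?implybT//; congr (_ `^ _); ring.
by rewrite powR_mulrn ?(ltW x0)// exprM; ring.
Qed.

(** The functional equation of Gamma and [fact_pochhammer] identify the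
    [j]-th term of a class; the power [m^(m j)] from the factorial turns
    [t^(m j)] into the [j]-th power of the hypergeometric argument. *)
Lemma moment_coef_residue_class (R : realType) (lambda t : R) (m p j : nat) :
  -1 < lambda -> (0 < m)%N ->
  moment_coef m t lambda (m * j + p) =
  m%:R^-1 * (t ^+ p / p`!%:R * Gamma ((lambda + p.+1%:R) / m%:R)) *
  ((\prod_(a <- [:: (lambda + p.+1%:R) / m%:R; 1]) pochhammer a j) /
   (\prod_(b <- [seq i%:R / m%:R | i <- index_iota p.+1 (m + p.+1)])
      pochhammer b j) * (((t / m%:R) ^+ m) ^+ j / j`!%:R)).
Proof.
move=> l1 m0; have m0R : m%:R != 0 :> R by rewrite pnatr_eq0 -lt0n.
rewrite /moment_coef big_map !big_cons big_nil mulr1 pochhammer1.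
set P := \prod_(_ <- _) _.
have P0 : P != 0.
  rewrite gt_eqF//; rewrite /P big_seq; apply: prodr_gt0 => i.
  rewrite mem_index_iota => /andP[pi _].
  by rewrite pochhammer_gt0// divr_gt0 ?ltr0n// (leq_trans _ pi).
have -> : (lambda + 1 + (m * j + p)%:R) / m%:R =
    (lambda + p.+1%:R) / m%:R + j%:R :> R.
  by rewrite natrD natrM -natr1; field.
rewrite GammaDn; last first.
  by rewrite divr_gt0 ?ltr0n// -nat1r addrA ltr_wpDr// -ltrBlDr sub0r.
rewrite fact_pochhammer// -/P -!exprM expr_div_n exprD.
field.
by rewrite P0 expf_neq0//= !pnatr_eq0 -!lt0n !fact_gt0 m0.
Qed.

(** One summand per residue class [p = k - 1] of the exponent of [t]
    modulo [m]. *)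
Lemma moment_eq_sum_hypergeometric (R : realType) (lambda t : R) (m : nat) :
  -1 < lambda -> (2 <= m)%N ->
  (\int[@lebesgue_measure R]_(s in `]0%R, +oo[)
     (s `^ lambda * expR (t * s - s ^+ m))%:E)%E =
  (m%:R^-1 * \sum_(1 <= k < m.+1)
     t ^+ (k - 1) / ((k - 1)`!)%:R * Gamma ((lambda + k%:R) / m%:R) *
     hypergeometric
       [:: (lambda + k%:R) / m%:R; 1]
       [seq j%:R / m%:R | j <- index_iota k (m + k)]
       ((t / m%:R) ^+ m))%:E.
Proof.
move=> l1 m2; have m0 : (0 < m)%N by exact: leq_trans m2.
have cn := @cvg_normed_series_moment_coef R lambda t m l1 m2.
rewrite -(cvg_lim _ (@cvg_series_moment_coef R lambda t m l1 m2))//.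
rewrite EFin_lim; last exact: normed_cvg.
congr (_%:E); rewrite (lim_series_residue_classes m0 cn).
rewrite big_add1/= mulr_sumr; apply: eq_big_nat => p /andP[_ pm].
rewrite subn1/= /hypergeometric mulrA -lim_seriesMl.
  by congr (limn (series _)); apply/funext => j; exact: moment_coef_residue_class.
under [X in series X]eq_fun do rewrite -moment_coef_residue_class//.
exact: cvg_series_residue_class.
Qed.

(** Parameters equal to [1] contribute [(1)_j = j!] above and below. *)
Lemma hypergeometric_cancel1 (R : realType) (a b z : R) (B1 B2 : seq R) :
  b = 1 ->
  hypergeometric [:: a; 1] (B1 ++ b :: B2) z = hypergeometric [:: a] (B1 ++ B2) z.
Proof.
move=> ->; rewrite /hypergeometric; congr (limn (series _)); apply/funext => j.
rewrite !big_cat !big_cons !big_nil/= !mulr1 pochhammer1; congr (_ * _).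
by rewrite [X in X / _]mulrC [X in _ / X]mulrCA -mulf_div divff ?mul1r.
Qed.

Lemma cat_index_iota (a b c : nat) : (a <= b)%N -> (b <= c)%N ->
  index_iota a c = index_iota a b ++ index_iota b c.
Proof.
move=> ab bc; rewrite /index_iota -{2}(subnKC ab) -iotaD; congr (iota _ _).
by rewrite addnC addnBA// subnK.
Qed.

(** Among the lower parameters [k/m, ..., (m + k - 1)/m] is [m/m = 1]. *)
Lemma hypergeometric_cancel_iota (R : realType) (a z : R) (m k : nat) :
  (0 < k <= m)%N ->
  hypergeometric [:: a; 1] [seq j%:R / m%:R | j <- index_iota k (m + k)] z =
  hypergeometric [:: a]
    [seq j%:R / m%:R | j <- index_iota k m ++ index_iota m.+1 (m + k)] z.
Proof.
move=> /andP[k0 km]; rewrite (@cat_index_iota k m)//; last exact: leq_addr.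
have -> : index_iota m (m + k) = m :: index_iota m.+1 (m + k).
  by rewrite /index_iota addKn subnS addKn; case: k k0 {km}.
rewrite !map_cat hypergeometric_cancel1// divff// pnatr_eq0 -lt0n.
exact: leq_trans km.
Qed.

Theorem theorem3p1 (R : realType) (lambda t : R) (m : nat)
    (hlambda : -1 < lambda) (hm : (2 <= m)%N) :
  [/\ freud_moment0 m t lambda =
        (\int[@lebesgue_measure R]_(s in `]0%R, +oo[)
           (s `^ lambda * expR (t * s - s ^+ m))%:E)%E,
      freud_moment0 m t lambda =
        (m%:R^-1 * \sum_(1 <= k < m.+1)
           t ^+ (k - 1) / ((k - 1)`!)%:R * Gamma ((lambda + k%:R) / m%:R) *
           hypergeometric
             [:: (lambda + k%:R) / m%:R; 1]
             [seq j%:R / m%:R | j <- index_iota k (m + k)]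
             ((t / m%:R) ^+ m))%:E
    & freud_moment0 m t lambda =
        (m%:R^-1 * Gamma ((lambda + 1) / m%:R) *
           hypergeometric
             [:: (lambda + 1) / m%:R]
             [seq j%:R / m%:R | j <- index_iota 1 m]
             ((t / m%:R) ^+ m)
         + m%:R^-1 * (\sum_(2 <= k < m)
             t ^+ (k - 1) / ((k - 1)`!)%:R * Gamma ((lambda + k%:R) / m%:R) *
             hypergeometric
               [:: (lambda + k%:R) / m%:R]
               [seq j%:R / m%:R |
                  j <- index_iota k m ++ index_iota m.+1 (m + k)]
               ((t / m%:R) ^+ m))
         + t ^+ (m - 1) / (m`!)%:R * Gamma (lambda / m%:R + 1) *
           hypergeometric
             [:: lambda / m%:R + 1]
             [seq j%:R / m%:R | j <- index_iota m.+1 (2 * m)]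
             ((t / m%:R) ^+ m))%:E].
Proof.
have m0 : (0 < m)%N by exact: leq_trans hm.
have m0R : m%:R != 0 :> R by rewrite pnatr_eq0 -lt0n.
rewrite freud_moment0_half_line moment_eq_sum_hypergeometric//.
split=> //; congr (_%:E).
rewrite big_ltn ?ltnS// big_nat_recr//=.
rewrite !hypergeometric_cancel_iota ?m0 ?leqnn//.
have -> : \sum_(2 <= k < m)
    t ^+ (k - 1) / ((k - 1)`!)%:R * Gamma ((lambda + k%:R) / m%:R) *
    hypergeometric [:: (lambda + k%:R) / m%:R; 1]
      [seq j%:R / m%:R | j <- index_iota k (m + k)] ((t / m%:R) ^+ m) =
    \sum_(2 <= k < m)
    t ^+ (k - 1) / ((k - 1)`!)%:R * Gamma ((lambda + k%:R) / m%:R) *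
    hypergeometric [:: (lambda + k%:R) / m%:R]
      [seq j%:R / m%:R | j <- index_iota k m ++ index_iota m.+1 (m + k)]
      ((t / m%:R) ^+ m).
  apply: eq_big_nat => k /andP[k2 km].
  by rewrite hypergeometric_cancel_iota// (ltnW km) andbT (leq_trans _ k2).
rewrite addn1 /index_iota !subnn !cats0 mul2n -addnn.
have -> : (lambda + m%:R) / m%:R = lambda / m%:R + 1 by field.
have -> : t ^+ (m - 1) / m`!%:R = m%:R^-1 * (t ^+ (m - 1) / (m - 1)`!%:R).
  rewrite -{2}(prednK m0) factS subn1 (prednK m0) natrM; field.
  by rewrite m0R pnatr_eq0 -lt0n fact_gt0.
by rewrite expr0 fact0 divr1 mul1r !mulrDr !mulrA addrA.
Qed.
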